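(* Let $\Omega$ be a bounded domain in $\mathbb{R}^n$, and let $\mathcal{A}_{jk}=\mathcal{A}_{kj}$ and $\mathcal{A}_j$ ($1\le j,k\le n$) be bounded real $(m\times m)$-matrix-valued functions in $\Omega$. Assume that the operator $$\mathfrak{A}(x,D_x)\boldsymbol u=\sum_{j,k=1}^n\mathcal{A}_{jk}(x)\frac{\partial^2\boldsymbol u}{\partial x_j\partial x_k}+\sum_{j=1}^n\mathcal{A}_j(x)\frac{\partial\boldsymbol u}{\partial x_j},\qquad \boldsymbol u=(u_1,\dots,u_m),$$ is uniformly strongly elliptic in $\Omega$, i.e. there is a constant $\delta>0$ such that $$\Bigl(\sum_{j,k=1}^n\mathcal{A}_{jk}(x)\sigma_j\sigma_k\boldsymbol\zeta,\boldsymbol\zeta\Bigr)\ge\delta|\boldsymbol\sigma|^2|\boldsymbol\zeta|^2$$ for all $\boldsymbol\sigma=(\sigma_1,\dots,\sigma_n)\in\mathbb{R}^n$, $\boldsymbol\zeta\in\mathbb{R}^m$ and $x\in\Omega$. Let $\mathfrak{S}$ be a convex body in $\mathbb{R}^m$, and suppose that there are functions $a_{jk},a_j:\Omega\times\mathfrak{N}_{\mathfrak{S}}\to\mathbb{R}$, $1\le j,k\le n$, such that $${}^t\mathcal{A}_{jk}(x)\boldsymbol\nu=a_{jk}(x;\boldsymbol\nu)\boldsymbol\nu,\qquad {}^t\mathcal{A}_{j}(x)\boldsymbol\nu=a_{j}(x;\boldsymbol\nu)\boldsymbol\nu$$ for all $x\in\Omega$ and $\boldsymbol\nu\in\mathfrak{N}_{\mathfrak{S}}$.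 Then $\mathfrak{S}$ is invariant for the system $\mathfrak{A}(x,D_x)\boldsymbol u=\boldsymbol 0$ in $\Omega$.
   Context: $|\cdot|$ and $(\cdot,\cdot)$ denote the Euclidean length and inner product, and ${}^t\mathcal{A}$ is the transpose of the matrix $\mathcal{A}$. Convex body: a convex body $\mathfrak{S}$ in $\mathbb{R}^m$ is the closure of a convex proper subdomain (nonempty open convex set, not all of $\mathbb{R}^m$); it may be unbounded. $\partial^*\mathfrak{S}$ is the set of points $a\in\partial\mathfrak{S}$ at which the unit outward normal $\boldsymbol\nu(a)$ to $\partial\mathfrak{S}$ exists, and $\mathfrak{N}_{\mathfrak{S}}=\{\boldsymbol\nu(a):a\in\partial^*\mathfrak{S}\}$. Invariance: a set $\mathcal{S}\subset\mathbb{R}^m$ is called invariant for a second-order elliptic system in a domain $\Omega$ if every bounded classical solution $\boldsymbol u=(u_1,\dots,u_m)$ of the system which is continuous in $\overline\Omega$ (that is, $\boldsymbol u\in C^2(\Omega;\mathbb{R}^m)\cap C_b(\overline\Omega;\mathbb{R}^m)$) and satisfies $\boldsymbol u(x)\in\mathcal{S}$ for all $x\in\partial\Omega$ takes values in $\mathcal{S}$ everywhere in $\Omega$. *)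

(* Defs.v *)
From HB Require Import structures.
From mathcomp Require Import all_boot all_order all_algebra.
From mathcomp Require Import all_classical all_reals all_analysis.

Set Implicit Arguments.
Unset Strict Implicit.
Unset Printing Implicit Defensive.

Import Order.TTheory GRing.Theory Num.Theory.
Import numFieldNormedType.Exports.

Local Open Scope classical_set_scope.
Local Open Scope ring_scope.

(* The library's norm on ['cV[R]_n] is the sup norm: it gives the usual topology
   and notion of boundedness, but not the Euclidean length, hence [enorm]. *)
Definition dot (R : realType) (n : nat) (u v : 'cV[R]_n) : R :=
  \sum_(i < n) u i 0 * v i 0.

Definition enorm (R : realType) (n : nat) (v : 'cV[R]_n) : R :=
  Num.sqrt (dot v v).

Definition boundary (T : topologicalType) (A : set T) : set T :=
  closure A `\` interior A.

Definition domain (R : realType) (n : nat) (Omega : set 'cV[R]_n) : Prop :=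
  [/\ open Omega, Omega !=set0 & connected Omega].

Definition convex_body (R : realType) (m : nat) (S : set 'cV[R]_m) : Prop :=
  exists D : set 'cV[R]_m,
    [/\ open D, D !=set0, convex_set (D : set (convex_lmodType 'cV[R]_m)),
        D <> setT & S = closure D].

Definition is_unit_outward_normal (R : realType) (m : nat) (S : set 'cV[R]_m)
    (a nu : 'cV[R]_m) : Prop :=
  enorm nu = 1 /\ forall y, S y -> dot nu (y - a) <= 0.

(* Every boundary point of a convex body has a unit outward normal in the sense
   of [is_unit_outward_normal]; "the" normal exists at [a] when there is exactly
   one, i.e. when the supporting hyperplane at [a] is the tangent hyperplane. *)
Definition unit_normals (R : realType) (m : nat) (S : set 'cV[R]_m) :
    set 'cV[R]_m :=
  [set nu | exists2 a, boundary S a & unique (is_unit_outward_normal S a) nu].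

Definition partial (R : realType) (n m : nat) (j : 'I_n)
    (u : 'cV[R]_n -> 'cV[R]_m) : 'cV[R]_n -> 'cV[R]_m :=
  'D_(delta_mx j 0) u.

Definition partially_derivable (R : realType) (n m : nat)
    (Omega : set 'cV[R]_n) (j : 'I_n) (u : 'cV[R]_n -> 'cV[R]_m) : Prop :=
  forall x, Omega x -> derivable u x (delta_mx j 0).

Definition continuous_on (R : realType) (n m : nat) (Omega : set 'cV[R]_n)
    (u : 'cV[R]_n -> 'cV[R]_m) : Prop :=
  forall x, Omega x -> {for x, continuous u}.

Definition class_C2 (R : realType) (n m : nat) (Omega : set 'cV[R]_n)
    (u : 'cV[R]_n -> 'cV[R]_m) : Prop :=
  [/\ continuous_on Omega u,
      forall j, partially_derivable Omega j u /\
                continuous_on Omega (partial j u)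
    & forall j k, partially_derivable Omega j (partial k u) /\
                  continuous_on Omega (partial j (partial k u))].

Definition second_order_op (R : realType) (n m : nat)
    (A2 : 'I_n -> 'I_n -> 'cV[R]_n -> 'M[R]_m)
    (A1 : 'I_n -> 'cV[R]_n -> 'M[R]_m)
    (u : 'cV[R]_n -> 'cV[R]_m) (x : 'cV[R]_n) : 'cV[R]_m :=
  \sum_(j < n) \sum_(k < n) A2 j k x *m partial j (partial k u) x
  + \sum_(j < n) A1 j x *m partial j u x.

Definition uniformly_strongly_elliptic (R : realType) (n m : nat)
    (Omega : set 'cV[R]_n) (A2 : 'I_n -> 'I_n -> 'cV[R]_n -> 'M[R]_m) : Prop :=
  exists2 delta : R, 0 < delta &
    forall (sigma : 'cV[R]_n) (zeta : 'cV[R]_m) (x : 'cV[R]_n), Omega x ->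
      delta * enorm sigma ^+ 2 * enorm zeta ^+ 2 <=
      dot ((\sum_(j < n) \sum_(k < n)
              (sigma j 0 * sigma k 0) *: A2 j k x) *m zeta) zeta.

(* Functions on [Omega] or on its closure are represented by total functions
   whose values elsewhere are irrelevant. *)
Definition invariant_set (R : realType) (n m : nat)
    (L : ('cV[R]_n -> 'cV[R]_m) -> 'cV[R]_n -> 'cV[R]_m)
    (Omega : set 'cV[R]_n) (S : set 'cV[R]_m) : Prop :=
  forall u : 'cV[R]_n -> 'cV[R]_m,
    class_C2 Omega u ->
    {within closure Omega, continuous u} ->
    [bounded u x | x in closure Omega] ->
    (forall x, Omega x -> L u x = 0) ->
    (forall x, boundary Omega x -> S (u x)) ->
    forall x, Omega x -> S (u x).

(* Main.v *)
(* Let [y] be a point outside the body. Some boundary point [a] of the body is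
   touched from inside by a ball and has its supporting hyperplane between [y] and
   the body; a touching ball forces the normal [nu] at [a] to be unique, so [nu] is
   a common eigenvector of all the transposed coefficients. Hence [dot nu u] solves
   a scalar elliptic equation with bounded coefficients, and by the weak maximum
   principle it stays below [dot nu a] in Omega, so that [u] never takes the
   value [y]. *)

Require Import Defs.
From HB Require Import structures.
From mathcomp Require Import all_boot all_order all_algebra.
From mathcomp Require Import all_classical all_reals all_analysis.
From mathcomp Require Import ring lra.

Set Implicit Arguments.
Unset Strict Implicit.
Unset Printing Implicit Defensive.

Import Order.TTheory GRing.Theory Num.Theory.
Import numFieldNormedType.Exports.

Local Open Scope classical_set_scope.
Local Open Scope ring_scope.

(** The eigenvector hypothesis concerns only points with a unique normal, so plain separation of [y]
    from the body is not enough: its hyperplane may touch the body at a corner. Good points are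
    found as points of the complement of the open convex set nearest to a point inside it, since the
    ball realising that distance touches there. On the analytic side, [class_C2] provides partial
    derivatives and their continuity, whereas the Hessian test at a maximum needs derivatives in
    every direction; these are rebuilt from the partials with the mean value theorem. Pairing the
    Hessian with the coefficients gives only a weak inequality at a maximum, hence the small barrier
    term that makes it strict. *)

(** * Euclidean inner product *)

Section Dot.
Context {R : realType} {n : nat}.
Implicit Types (u v w : 'cV[R]_n) (a : R).

Lemma dotC u v : dot u v = dot v u.
Proof. by apply: eq_bigr => i _; rewrite mulrC. Qed.

Lemma dotDl u v w : dot (u + v) w = dot u w + dot v w.
Proof. by rewrite -big_split; apply: eq_bigr => i _; rewrite mxE mulrDl. Qed.

Lemma dotZl a u v : dot (a *: u) v = a * dot u v.
Proof. by rewrite mulr_sumr; apply: eq_bigr => i _; rewrite mxE mulrA. Qed.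

Lemma dotNl u v : dot (- u) v = - dot u v.
Proof. by rewrite -scaleN1r dotZl mulN1r. Qed.

Lemma dotBl u v w : dot (u - v) w = dot u w - dot v w.
Proof. by rewrite dotDl dotNl. Qed.

Lemma dotDr u v w : dot w (u + v) = dot w u + dot w v.
Proof. by rewrite dotC dotDl !(dotC w). Qed.

Lemma dotZr a u v : dot u (a *: v) = a * dot u v.
Proof. by rewrite dotC dotZl dotC. Qed.

Lemma dotNr u v : dot u (- v) = - dot u v.
Proof. by rewrite dotC dotNl dotC. Qed.

Lemma dotBr u v w : dot w (u - v) = dot w u - dot w v.
Proof. by rewrite dotDr dotNr. Qed.

Definition dotE := (dotDl, dotDr, dotNl, dotNr, dotZl, dotZr).

Lemma dot_delta i v : dot (delta_mx i 0) v = v i 0.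
Proof.
rewrite /dot (bigD1 i)//= big1 ?addr0 => [|k ki]; first by rewrite mxE !eqxx mul1r.
by rewrite mxE (negbTE ki) mul0r.
Qed.

Lemma dot_sumr (I : finType) (F : I -> 'cV[R]_n) u :
  dot u (\sum_i F i) = \sum_i dot u (F i).
Proof.
elim/big_ind2: _ => [|x a y b <- <-|//]; last by rewrite dotDr.
by rewrite /dot big1// => i _; rewrite mxE mulr0.
Qed.

Lemma dot_ge0 u : 0 <= dot u u.
Proof. by apply: sumr_ge0 => i _; rewrite -expr2 sqr_ge0. Qed.

Lemma dot_eq0 u : dot u u = 0 -> u = 0.
Proof.
move/eqP; rewrite psumr_eq0 => [/allP u0|i _]; last by rewrite -expr2 sqr_ge0.
apply/colP => i; rewrite mxE; apply/eqP.
by have /(_ (mem_index_enum i)) := u0 i; rewrite mulf_eq0 orbb.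
Qed.

Lemma sqr_enorm u : enorm u ^+ 2 = dot u u.
Proof. by rewrite sqr_sqrtr// dot_ge0. Qed.

Lemma coord_dot_le u i : u i 0 ^+ 2 <= dot u u.
Proof.
by rewrite /dot (bigD1 i)//= -expr2 lerDl sumr_ge0// => j _; rewrite -expr2 sqr_ge0.
Qed.

Lemma dot_continuous u : continuous (dot u).
Proof.
apply: continuous_big => [|i _ x]; first exact: add_continuous.
by apply: continuousM; [exact: cst_continuous|exact: coord_continuous].
Qed.

Lemma dot_sub_continuous c : continuous (fun x : 'cV[R]_n => dot (x - c) (x - c)).
Proof.
apply: continuous_big => [|i _ x]; first exact: add_continuous.
have h : {for x, continuous (fun y : 'cV[R]_n => (y - c) i 0)}.
  rewrite (_ : (fun _ => _) = (fun y : 'cV[R]_n => y i 0 - c i 0)).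
    by apply: continuousB; [exact: coord_continuous|exact: cst_continuous].
  by apply/funext => y; rewrite !mxE.
exact: (continuousM h h).
Qed.

(** Bridge between Euclidean balls, in which the geometry is done, and the sup norm, which carries
    the topology. *)
Lemma norm_le_enorm v e : 0 <= e -> dot v v <= e ^+ 2 -> `|v| <= e.
Proof.
move=> e0 ve; rewrite [leLHS]/Num.norm/= mx_normrE.
apply: bigmax_le => // -[i j] _ /=; rewrite ord1.
rewrite -(ler_pXn2r (n := 2)) ?nnegrE// -normrX ger0_norm ?sqr_ge0//.
exact: le_trans (coord_dot_le v i) ve.
Qed.

End Dot.

(** * Matrices and quadratic forms *)

Lemma dot_mulmx (R : realType) (m n : nat) (A : 'M[R]_(m, n)) u v :
  dot (A *m u) v = dot u (A^T *m v).
Proof.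
have dotmx p (x y : 'cV[R]_p) : dot x y = (x^T *m y) 0 0.
  by rewrite mxE; apply: eq_bigr => i _; rewrite mxE.
by rewrite !dotmx trmx_mul mulmxA.
Qed.

(* Subtracting [(A i i)^-1 *: (r *m r^T)], with [r] the [i]-th column of [A], keeps
   [A] positive semidefinite and kills a nonzero diagonal entry. *)
Lemma symmetric_psd_trace_le0 (R : realType) (n : nat) (A H : 'M[R]_n) :
  A^T = A -> (forall v, 0 <= dot (A *m v) v) ->
  (forall v, dot (H *m v) v <= 0) ->
  \sum_i \sum_j A i j * H i j <= 0.
Proof.
move=> + + H_le0.
(* Induction on the number of nonzero diagonal entries; a positive semidefinite matrix with none is
   zero. *)
have [N] := ubnP #|[pred i | A i i != 0]|; elim: N A => // N IH A.
rewrite ltnS => leN As Apsd.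
have Aii i : dot (A *m delta_mx i 0) (delta_mx i 0) = A i i.
  by rewrite dotC dot_delta -colE mxE.
have Aij i j : dot (A *m delta_mx i 0) (delta_mx j 0) = A j i.
  by rewrite dotC dot_delta -colE mxE.
have Aji i j : A j i = A i j by rewrite -[in LHS]As mxE.
have [[i Ai0]|/forallNP A0] := pselect (exists i, A i i != 0); last first.
  suff -> : A = 0.
    rewrite big1// => i _; rewrite big1// => j _; by rewrite mxE mul0r.
  apply/matrixP => i j; rewrite mxE.
  have {}A0 k : A k k = 0 by apply/eqP; move/negP: (A0 k); rewrite negbK.
  (* With a zero diagonal the form at this vector equals [- 2 * A i j ^+ 2]. *)
  have := Apsd (delta_mx i 0 - A i j *: delta_mx j 0).
  rewrite mulmxBr -scalemxAr !dotE !Aij !A0 (Aji i j) => h.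
  have : A i j ^+ 2 <= 0 by lra.
  by rewrite real_exprn_even_le0 ?num_real// => /eqP.
have Ai_gt0 : 0 < A i i by rewrite lt_neqAle eq_sym Ai0 -Aii Apsd.
set r := A *m (delta_mx i 0 : 'cV[R]_n); set a := A i i.
pose B := A - a^-1 *: (r *m r^T).
have rr (v : 'cV[R]_n) : (r *m r^T) *m v = dot r v *: r.
  rewrite -mulmxA; apply/colP => k; rewrite !mxE big_ord1 mulrC.
  congr (_ * _); last by rewrite mxE.
  by rewrite mxE; apply: eq_bigr => l _; rewrite mxE.
have Bdot (w : 'cV[R]_n) : dot (B *m w) w = dot (A *m w) w - a^-1 * dot r w ^+ 2.
  by rewrite mulmxBl -scalemxAl rr dotBl !dotZl expr2.
have Bpsd (v : 'cV[R]_n) : 0 <= dot (B *m v) v.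
  (* This vector minimises the form of [A] on the line through [v] in direction [i], and the minimum
     is the form of [B] at [v]. *)
  have := Apsd (v - (dot r v / a) *: delta_mx i 0).
  rewrite Bdot mulmxBr -scalemxAr -/r.
  have -> x : dot (x - (dot r v / a) *: r) (v - (dot r v / a) *: delta_mx i 0)
     = dot x v - dot r v / a * dot x (delta_mx i 0)
       - dot r v / a * dot r v + (dot r v / a) ^+ 2 * dot r (delta_mx i 0).
    by rewrite !dotE; ring.
  have -> : dot (A *m v) (delta_mx i 0) = dot r v by rewrite dot_mulmx As dotC.
  rewrite Aii -/a.
  have -> : dot (A *m v) v - dot r v / a * dot r v - dot r v / a * dot r v
    + (dot r v / a) ^+ 2 * a = dot (A *m v) v - a^-1 * dot r v ^+ 2 by field.
  by [].
have Bs : B^T = B by rewrite /B linearB/= linearZ/= trmx_mul trmxK As.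
have Bkk k : B k k = A k k - a^-1 * r k 0 ^+ 2.
  by rewrite !mxE big_ord1 !mxE expr2.
have BE k l : B k l = A k l - a^-1 * (r k 0 * r l 0).
  by rewrite !mxE big_ord1 !mxE.
(* A vanishing [A k k] stays zero: [B k k] is then [- a^-1 * r k 0 ^+ 2], yet nonnegative by [Bpsd].
   So the count loses [i] and gains nothing. *)
have BN : (#|[pred i | B i i != 0%R]| < N)%N.
  apply: leq_trans leN; apply: proper_card; apply/properP; split.
    apply/fintype.subsetP => k; rewrite !inE; apply: contra => /eqP Akk.
    have := Bpsd (delta_mx k 0); rewrite dotC dot_delta -colE mxE Bkk Akk sub0r.
    rewrite oppr_ge0 => h; rewrite oppr_eq0 eq_le h/=.
    by rewrite mulr_ge0 ?sqr_ge0// invr_ge0 ltW.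
  exists i; rewrite !inE// negbK Bkk /r -colE mxE -/a.
  by apply/eqP; field.
have := IH B BN Bs Bpsd.
have -> : \sum_k \sum_j B k j * H k j =
   \sum_k \sum_j A k j * H k j - a^-1 * dot (H *m r) r.
  rewrite /dot mulr_sumr -sumrB; apply: eq_bigr => k _.
  rewrite mxE mulr_suml mulr_sumr -sumrB; apply: eq_bigr => l _.
  by rewrite BE; ring.
have : a^-1 * dot (H *m r) r <= 0.
  by rewrite pmulr_rle0 ?invr_gt0//; exact: H_le0.
lra.
Qed.

(** * Separation of a convex body from a point by a unique normal *)

Lemma nbhs_line (R : realType) (V : normedModType R) (x v : V) (B : set V) :
  nbhs x B -> exists2 e : R, 0 < e & forall s, `|s| < e -> B (x + s *: v).
Proof.
move=> Bx.
have line_cont : {for 0, continuous (fun s : R => x + s *: v)}.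
  apply: cvgD; first exact: cvg_cst.
  by apply: cvgZr_tmp; exact: cvg_id.
have : nbhs (0 : R) [set s | B (x + s *: v)].
  by apply: line_cont; rewrite scale0r addr0.
move=> /nbhs_ballP[e e0 eB]; exists e => // s se; apply: eB.
by rewrite /ball/= sub0r normrN.
Qed.

Lemma convex_setP (R : realType) (n : nat) (D : set 'cV[R]_n) x y (t : R) :
  convex_set (D : set (convex_lmodType 'cV[R]_n)) -> D x -> D y ->
  0 <= t <= 1 -> D (t *: x + (1 - t) *: y).
Proof.
move=> cD Dx Dy t01; have := cD x y (Itv01 (andP t01).1 (andP t01).2).
by rewrite !inE => /(_ Dx Dy).
Qed.

Lemma open_dot_ball (R : realType) (n : nat) (D : set 'cV[R]_n) d :
  open D -> D d ->
  exists2 r : R, 0 < r & forall z, dot (z - d) (z - d) <= r ^+ 2 -> D z.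
Proof.
move=> oD Dd; have := open_nbhs_nbhs (conj oD Dd).
move=> /nbhs_ballP[e /= e0 eD]; exists (e / 2); first by rewrite divr_gt0.
move=> z zd; apply: eD; rewrite -ball_normE/= distrC.
have e2 : 0 <= e / 2 by rewrite ltW// divr_gt0.
apply: le_lt_trans (norm_le_enorm e2 zd) _.
by rewrite ltr_pdivrMr// ltr_pMr// ltr1n.
Qed.

Lemma closed_halfspace (R : realType) (n : nat) (nu : 'cV[R]_n) (b : R) :
  closed [set z | dot nu z <= b].
Proof.
apply: (preimage_closed (f := dot nu) (D := [set x : R | x <= b])); last exact: closed_le.
by move=> x _; exact: dot_continuous.
Qed.

(* If some [z] in [D] were beyond the tangent hyperplane of the ball, then [a]
   would lie strictly between [z] and a point of the ball, hence in [D]. *)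
Lemma touching_ball_normal (R : realType) (n : nat) (D : set 'cV[R]_n)
    (c a : 'cV[R]_n) (e : R) :
  convex_set (D : set (convex_lmodType 'cV[R]_n)) -> ~ D a -> 0 < e ->
  dot (a - c) (a - c) = e ^+ 2 ->
  (forall z, dot (z - c) (z - c) < e ^+ 2 -> D z) ->
  boundary (closure D) a /\
  unique (is_unit_outward_normal (closure D) a) (e^-1 *: (a - c)).
Proof.
move=> cD nDa e0 ac ballD; set w := _ *: _.
have acE : a - c = e *: w by rewrite scalerA mulfV ?scale1r// gt_eqF.
have ww : dot w w = 1.
  by rewrite !dotZl !dotZr ac expr2; field; rewrite gt_eqF.
clearbody w.
have Dside z : D z -> dot w z <= dot w a.
  move=> Dz; rewrite leNgt; apply/negP => wza; apply: nDa.
  pose p := dot w z - dot w a; have p0 : 0 < p by rewrite subr_gt0.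
  pose N := dot (a - z) (a - z).
  have N0 : 0 <= N by exact: dot_ge0.
  (* Going from [a] away from [z] by the parameter [s] changes the squared distance to [c] by
     [- s * (2 * e * p - s * N)]. This choice gives [s * N < e * p], so the new point is inside the
     ball; the [+ 1] keeps the denominator positive. *)
  pose s := e * p / (N + 1).
  have s0 : 0 < s by rewrite divr_gt0 ?mulr_gt0// ltr_wpDl.
  have Dq : D (a + s *: (a - z)).
    apply: ballD.
    have -> : a + s *: (a - z) - c = e *: w + s *: (a - z).
      by rewrite -acE addrAC.
    have -> : dot (e *: w + s *: (a - z)) (e *: w + s *: (a - z)) =
        e ^+ 2 - s * (2 * e * p - s * N).
      have wb : dot w (a - z) = - p by rewrite dotBr opprB.
      move: wb; rewrite /N; generalize (a - z) => b wb.
      by rewrite dotDl !dotDr !dotZl !dotZr (dotC b w) wb ww; ring.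
    rewrite gtrBl pmulr_rgt0// subr_gt0.
    have -> : s * N = e * p * (N / (N + 1)) by rewrite /s; ring.
    have : N / (N + 1) < 2 by rewrite ltr_pdivrMr ?ltr_wpDl//; lra.
    have -> : 2 * e * p = e * p * 2 by ring.
    by rewrite ltr_pM2l// mulr_gt0.
  have -> : a = (1 + s)^-1 *: (a + s *: (a - z)) + (1 - (1 + s)^-1) *: z.
    apply/colP => i; rewrite !mxE; field.
    by rewrite gt_eqF// addr_gt0.
  apply: convex_setP => //; rewrite invr_ge0 addr_ge0 ?(ltW s0)//=.
  by rewrite invf_le1 ?lerDl ?(ltW s0)// ltr_wpDr// ltW.
have Sside z : closure D z -> dot w (z - a) <= 0.
  move=> Dz; rewrite dotBr subr_le0.
  have /closure_id hE := @closed_halfspace _ _ w (dot w a).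
  suff : [set z | dot w z <= dot w a] z by [].
  by rewrite hE; exact: closureS Dz.
split; split.
- apply: subset_closure => B /(nbhs_line w)[r r0 rB].
  pose s := Num.min (r / 2) e.
  have s0 : 0 < s by rewrite lt_min e0 divr_gt0.
  exists (a + (- s) *: w); split; last first.
    apply: rB; rewrite normrN gtr0_norm// gt_min.
    by rewrite ltr_pdivrMr// ltr_pMr// ltr1n.
  apply: ballD; have -> : a + - s *: w - c = (e - s) *: w.
    by rewrite addrAC acE -scalerDl.
  rewrite dotZl dotZr ww mulr1 -expr2.
  rewrite ltr_pXn2r ?nnegrE ?subr_ge0 ?ge_min ?lexx ?orbT ?ltW//.
  by rewrite gtrBl.
- move=> /(nbhs_line w)[r r0 rS].
  have : closure D (a + (r / 2) *: w).
    apply: rS; rewrite gtr0_norm ?divr_gt0//.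
    by rewrite ltr_pdivrMr// ltr_pMr// ltr1n.
  move=> /Sside; rewrite addrAC subrr add0r dotZr ww mulr1 leNgt.
  by rewrite divr_gt0.
- by split => //; rewrite /enorm ww sqrtr1.
- move=> nu [nu1 nuS].
  have nn : dot nu nu = 1 by rewrite -sqr_enorm nu1 expr1n.
  (* For [0 <= t < e] the point [c + t *: nu] is in the ball, so normality of [nu] forces
     [t <= e * dot w nu]. If [dot w nu < 1], the midpoint of [e * dot w nu] and [e], cut off at 0,
     violates this. Two unit vectors with inner product at least 1 coincide. *)
  have wnu : 1 <= dot w nu.
    rewrite leNgt; apply/negP => lt1.
    pose t := Num.max (e * dot w nu / 2 + e / 2) 0.
    have te : t < e.
      rewrite gt_max e0 andbT -ltrBrDr.
      rewrite ltr_pdivrMr//.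
      have : e * dot w nu < e by rewrite gtr_pMr.
      lra.
    have t0 : 0 <= t by rewrite le_max lexx orbT.
    have : closure D (c + t *: nu).
      apply: subset_closure; apply: ballD.
      by rewrite addrAC subrr add0r dotZl dotZr nn mulr1 -expr2
        ltr_pXn2r ?nnegrE ?(ltW e0).
    move=> /nuS.
    have -> : c + t *: nu - a = t *: nu - e *: w.
      by rewrite -acE; apply/colP => i; rewrite !mxE; ring.
    rewrite dotBr !dotZr nn mulr1 subr_le0 (dotC nu) leNgt => /negP; apply.
    rewrite lt_max; apply/orP; left.
    have : e * dot w nu < e by rewrite gtr_pMr.
    lra.
  apply/eqP; rewrite -subr_eq0; apply/eqP; apply: dot_eq0.
  apply/eqP; rewrite eq_le dot_ge0 andbT.
  rewrite dotBl !dotBr ww nn (dotC nu); lra.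
Qed.

Lemma trmx_continuous (R : realType) (m n : nat) :
  continuous (trmx : 'M[R]_(m, n) -> 'M[R]_(n, m)).
Proof.
move=> M s /= /(nbhs_ballP M^T)[e e0 es].
apply/nbhs_ballP; exists e => // N [_ MN]; apply: es; split => // i j.
by rewrite !mxE; exact: MN.
Qed.

(** Heine-Borel for row vectors, carried over by transposition, which is continuous and preserves
    the sup norm. *)
Lemma bounded_closed_compact_cV (R : realType) (n : nat) (A : set 'cV[R]_n) :
  bounded_set A -> closed A -> compact A.
Proof.
move=> bA cA.
have -> : A = trmx @` (trmx @^-1` A : set 'rV[R]_n).
  apply/seteqP; split=> [x Ax|_ [y Ay <-]//]; exists x^T; rewrite ?trmxK//=.
  by rewrite trmxK.
apply: continuous_compact.
  by apply: continuous_subspaceT; exact: trmx_continuous.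
apply: bounded_closed_compact; last first.
  by apply: preimage_closed => // x _; exact: trmx_continuous.
move: bA => [M [Mr bM]]; exists M; split => // x Mx y /= /(bM _ Mx) /=.
apply: le_trans; rewrite /Num.norm/= !mx_normrE.
apply: bigmax_le => [|[i j] _ /=]; first exact: bigmax_ge_id.
have -> : y i j = y^T j i by rewrite mxE.
exact: (le_bigmax _ (fun p => `|y^T p.1 p.2|) (j, i)).
Qed.

Lemma exists_nearest_point (R : realType) (n : nat) (C : set 'cV[R]_n) c :
  closed C -> C !=set0 ->
  exists2 a, C a & forall z, C z -> dot (a - c) (a - c) <= dot (z - c) (z - c).
Proof.
move=> clC [z0 Cz0]; pose f z : R := dot (z - c) (z - c).
(* [C] may be unbounded; cutting it at the distance of one of its points makes it compact and keeps
   every candidate minimiser. *)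
pose K := C `&` [set z | f z <= f z0].
have Kz0 : K z0 by split => //=.
have f_cont : continuous f by exact: dot_sub_continuous.
have clK : closed K.
  apply: closedI => //.
  apply: (preimage_closed (f := f) (D := [set x : R | x <= f z0])).
    by move=> x _; exact: f_cont.
  exact: closed_le.
have bK : bounded_set K.
  exists (enorm (z0 - c) + `|c|); split; first exact: num_real.
  move=> M /ltW hM z [_ /= fz]; apply: le_trans hM.
  rewrite -{1}(subrK c z) (le_trans (ler_normD _ _))// lerD2r.
  by apply: norm_le_enorm; [exact: sqrtr_ge0|rewrite sqr_enorm].
have [a Ka amin] := compact_EVT_min (ex_intro _ _ Kz0)
  (bounded_closed_compact_cV bK clK) (continuous_subspaceT f_cont).
move: Ka; rewrite inE => -[Ca _]; exists a => // z Cz.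
have [fz|/ltW fz] := leP (f z) (f z0); first by apply: amin; rewrite inE.
by apply: le_trans fz; apply: amin; rewrite inE.
Qed.

(* A ball centred on a segment from an interior point [d] to [y], close to where
   the segment leaves [D], is so small that the supporting hyperplane at its
   touching point, which leaves a fixed ball around [d] on one side, has [y] on
   the other side. *)
Lemma unit_normal_separates (R : realType) (m : nat) (S : set 'cV[R]_m) y :
  convex_body S -> ~ S y ->
  exists nu b, [/\ unit_normals S nu, forall z, S z -> dot nu z <= b
    & b < dot nu y].
Proof.
move=> [D [oD [d Dd] cD _ ->]] nSy.
have nDy : ~ D y by move=> /subset_closure.
have [r r0 ballr] := open_dot_ball oD Dd.
pose l (t : R) := d + t *: (y - d).
have lD s t : l (s + t) = l s + t *: (y - d) by rewrite /l scalerDl addrA.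
have l1 : l 1 = y by rewrite /l scale1r addrC subrK.
pose E := [set t | 0 <= t <= 1 /\ D (l t)].
have E0 : E 0 by split; [rewrite lexx ler01|rewrite /l scale0r addr0].
have supE : has_sup E.
  by split; [exists 0|exists 1 => t [/andP[]]].
set t0 := sup E.
have t0_ge0 : 0 <= t0 by exact: sup_upper_bound.
have t0_le1 : t0 <= 1 by apply: ge_sup => [|t [/andP[]//]]; exists 0.
(* If [t0] were 1, points of [D] on the segment would accumulate at [y], which lies outside the
   closure of [D]. *)
have t0_lt1 : t0 < 1.
  rewrite lt_neqAle t0_le1 andbT; apply/eqP => t01; apply: nSy => B.
  move=> /(nbhs_line (y - d))[e e0 eB].
  have [t [/andP[_ t1] Dt]] := sup_adherent e0 supE.
  rewrite -/t0 t01 => te; exists (l t); split => //.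
  rewrite -(subrK 1 t) addrC lD l1; apply: eB.
  by rewrite ler0_norm ?subr_le0//; lra.
have nDt0 : ~ D (l t0).
  move=> Dt0; have := open_nbhs_nbhs (conj oD Dt0).
  move=> /(nbhs_line (y - d))[e e0 eD].
  pose s := Num.min (e / 2) (1 - t0).
  have s0 : 0 < s by rewrite lt_min divr_gt0//= subr_gt0.
  have se : s < e by rewrite gt_min ltr_pdivrMr// ltr_pMr// ltr1n.
  have s1 : s <= 1 - t0 by rewrite ge_min lexx orbT.
  have : E (t0 + s).
    split; first by apply/andP; split; lra.
    by rewrite lD; apply: eD; rewrite gtr0_norm.
  move=> /(sup_upper_bound supE); rewrite -/t0; lra.
pose N := enorm (y - d).
have N0 : 0 <= N by exact: sqrtr_ge0.
(* Chosen so that for [t] within [eta] of [t0] the distance from [l t] to the complement of [D], at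
   most [(t0 - t) * N], is below [(1 - t) * r]. *)
pose eta := (1 - t0) * r / (N + 1).
have eta0 : 0 < eta by rewrite divr_gt0 ?mulr_gt0 ?subr_gt0 ?ltr_wpDl.
have etaN : eta * N < (1 - t0) * r.
  rewrite /eta -mulrA gtr_pMr ?mulr_gt0 ?subr_gt0//.
  by rewrite mulrC ltr_pdivrMr ?ltr_wpDl//; lra.
have [t Et] := sup_adherent eta0 supE.
have tt0 : t <= t0 by exact: sup_upper_bound.
rewrite -/t0 => t_eta; move: Et => [/andP[t_ge0 t_le1] Dt].
have [a nDa amin] : exists2 a, (~` D) a & forall z, (~` D) z ->
    dot (a - l t) (a - l t) <= dot (z - l t) (z - l t).
  by apply: exists_nearest_point; [exact: open_closedC|exists (l t0)].
pose e := enorm (a - l t).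
have eE : dot (a - l t) (a - l t) = e ^+ 2 by rewrite sqr_enorm.
have e0 : 0 < e.
  rewrite lt_neqAle sqrtr_ge0 andbT; apply/eqP => /esym e0.
  by move: eE; rewrite e0 expr0n/= => /dot_eq0/subr0_eq aE; apply: nDa; rewrite aE.
have e_lt : e < (1 - t) * r.
  have : e <= (t0 - t) * N.
    rewrite -(ler_pXn2r (n := 2)) ?nnegrE ?mulr_ge0 ?subr_ge0// ?(ltW e0)//.
    rewrite -eE exprMn sqr_enorm; apply: le_trans (amin _ nDt0) _.
    have -> : l t0 - l t = (t0 - t) *: (y - d).
      by apply/colP => i; rewrite !mxE; ring.
    by rewrite dotZl dotZr mulrA expr2.
  have : (t0 - t) * N <= eta * N by rewrite ler_wpM2r//; lra.
  have : (1 - t0) * r <= (1 - t) * r by rewrite ler_wpM2r ?(ltW r0)//; lra.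
  lra.
have ballD z : dot (z - l t) (z - l t) < e ^+ 2 -> D z.
  by apply: contraPP => nDz; rewrite -eE; apply/negP; rewrite -leNgt; exact: amin.
have [bda nua] := touching_ball_normal cD nDa e0 eE ballD.
move: nua; set nu := _ *: _ => nua.
have nun : dot nu nu = 1 by rewrite -sqr_enorm nua.1.1 expr1n.
exists nu, (dot nu a); split.
- by exists a.
- by move=> z /nua.1.2; rewrite dotBr subr_le0.
- have nul : dot nu (l t) = dot nu a - e.
    have -> : l t = a - e *: nu.
      by rewrite scalerA mulfV ?gt_eqF// scale1r opprB addrC subrK.
    by rewrite dotBr dotZr nun mulr1.
  have nud : dot nu d + r <= dot nu a.
    have : closure D (d + r *: nu).
      apply: subset_closure; apply: ballr.
      by rewrite addrAC subrr add0r dotZl dotZr nun mulr1 expr2.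
    by move=> /nua.1.2; rewrite dotBr dotDr dotZr nun mulr1 subr_le0.
  move: nul; rewrite /l dotDr dotZr dotBr => nul.
  (* If [dot nu y <= dot nu a], then with [nud] the convex combination [l t] satisfies
     [dot nu (l t) <= dot nu a - (1 - t) * r]. By [nul] this says [(1 - t) * r <= e], against
     [e_lt]. *)
  rewrite ltNge; apply/negP => yb.
  have : t * (dot nu y - dot nu d) =
      t * (dot nu y - dot nu a) + t * (dot nu a - dot nu d) by ring.
  have : t * (dot nu y - dot nu a) <= 0 by rewrite mulr_ge0_le0// subr_le0.
  have : (1 - t) * r <= (1 - t) * (dot nu a - dot nu d).
    by rewrite ler_wpM2l//; lra.
  lra.
Qed.

(** * Second-order conditions at an interior maximum *)

(** Both difference quotients are the same function; this opens the one-variable theorems to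
    directional derivatives. *)
Lemma is_derive_line (R : realType) (V W : normedModType R) (f : V -> W)
    (x v : V) (t : R) (d : W) :
  is_derive (x + t *: v) v f d <-> is_derive t 1 (fun s => f (x + s *: v)) d.
Proof.
have E : (fun h : R => h^-1 *: ((f \o shift (x + t *: v)) (h *: v) - f (x + t *: v)))
  = (fun h : R => h^-1 *: (((fun s => f (x + s *: v)) \o shift t) (h *: (1 : R))
                 - f (x + t *: v))).
  apply/funext => h /=; congr (_ *: (f _ - _)).
  by rewrite [_%:A]mulr1 scalerDl addrCA.
by split=> -[D <-]; apply: DeriveDef; rewrite /derivable /derive ?E// -E.
Qed.

Lemma MVT_line (R : realType) (V : normedModType R) (f g : V -> R) (x v : V)
    (k : R) :
  (forall t, `|t| <= `|k| -> is_derive (x + t *: v) v f (g (x + t *: v))) ->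
  exists2 t, `|t| <= `|k| & f (x + k *: v) - f x = k * g (x + t *: v).
Proof.
move=> fg; pose phi t := f (x + t *: v).
have phiD (t : R) : `|t| <= `|k| -> is_derive t 1 phi (g (x + t *: v)).
  by move=> /fg/is_derive_line.
have phiC (a b : R) : (forall t, t \in `[a, b] -> `|t| <= `|k|) ->
    {within `[a, b], continuous phi}.
  by move=> ab; apply: derivable_within_continuous => t /ab /phiD[].
have phi0 : phi 0 = f x by rewrite /phi scale0r addr0.
rewrite -phi0 -/(phi k).
have [k0|/ltW k0] := leP 0 k.
  have sub (t : R) : t \in `[0, k] -> `|t| <= `|k|.
    by rewrite in_itv/= => /andP[t0 tk]; rewrite !ger0_norm.
  have [||c /sub ck ->] := @MVT_segment _ phi (fun t => g (x + t *: v)) _ _ k0.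
  - by move=> t /subset_itv_oo_cc/sub; exact: phiD.
  - exact: phiC.
  by exists c => //; rewrite subr0 mulrC.
have sub (t : R) : t \in `[k, 0] -> `|t| <= `|k|.
  by rewrite in_itv/= => /andP[t0 tk]; rewrite !ler0_norm// lerN2.
have [||c /sub ck E] := @MVT_segment _ phi (fun t => g (x + t *: v)) _ _ k0.
- by move=> t /subset_itv_oo_cc/sub; exact: phiD.
- exact: phiC.
by exists c => //; rewrite -opprB E sub0r mulrN opprK mulrC.
Qed.

(** The increment splits into a step [h *: v] followed by a step [(h * c) *: e]. By the mean value
    theorem the second equals [h * c] times a value of [g] near [x], and continuity of [g] gives the
    limit. *)
Lemma is_derive_add_direction (R : realType) (V : normedModType R)
    (f g : V -> R) (x v e : V) (c d : R) :
  (\forall y \near x, is_derive y e f (g y)) -> {for x, continuous g} ->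
  is_derive x v f d -> is_derive x (v + c *: e) f (d + c * g x).
Proof.
move=> fg gx [fv <-].
suff cv : (fun h : R => h^-1 *: ((f \o shift x) (h *: (v + c *: e)) - f x)) @ 0^'
    --> 'D_v f x + c * g x.
  by apply: DeriveDef; [apply/cvg_ex; exists ('D_v f x + c * g x)|exact/cvg_lim].
have -> : (fun h : R => h^-1 *: ((f \o shift x) (h *: (v + c *: e)) - f x)) =
  (fun h : R => h^-1 *: ((f \o shift x) (h *: v) - f x)) +
  (fun h : R => h^-1 *: (f (x + h *: v + (h * c) *: e) - f (x + h *: v))).
  apply/funext => h /=; rewrite [RHS]/GRing.add/= -scalerDr; congr (_ *: _).
  rewrite (addrC (h *: v) x) [RHS]addrC addrA subrK; congr (f _ - _).
  by rewrite scalerDr scalerA addrC addrA.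
apply: cvgD => //; apply/cvgrPdist_le => eps eps0.
pose eps' := eps / (`|c| + 1).
have c1 : 0 < `|c| + 1 by rewrite ltr_wpDl.
have eps'0 : 0 < eps' by rewrite divr_gt0.
have near_x : \forall y \near x, is_derive y e f (g y) /\ `|g x - g y| <= eps'.
  by near=> y; split; near: y => //; move/cvgrPdist_le: gx; apply.
have [r /= r0 rP] := (nbhs_normP _ _).1 near_x.
(* [|h| * N] bounds the displacement from [x] of every point met on the two steps. *)
pose N := `|v| + `|c| * `|e| + 1.
have N0 : 0 < N by rewrite ltr_wpDl// addr_ge0// mulr_ge0.
near=> h.
have h0 : h != 0 by near: h; exact: nbhs_dnbhs_neq.
have hN : `|h| * N < r.
  rewrite -ltr_pdivlMr//; near: h; apply: dnbhs0_lt; exact: divr_gt0.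
have close t : `|t| <= `|h * c| -> `|x - (x + h *: v + t *: e)| < r.
  move=> tc; apply: le_lt_trans hN; rewrite -addrA opprD addrA subrr sub0r normrN.
  rewrite (le_trans (ler_normD _ _))// !normrZ /N !mulrDr mulr1.
  have : `|t| * `|e| <= `|h * c| * `|e| by rewrite ler_wpM2r.
  have : 0 <= `|h| by [].
  rewrite normrM -mulrA; lra.
have [|t tc ->] := @MVT_line _ _ f g (x + h *: v) e (h * c).
  by move=> t tc; have [] := rP _ (close _ tc).
have [_ gt] := rP _ (close _ tc).
rewrite -[_ *: _]/(_ * _) -mulrA mulKf// -mulrBr normrM.
apply: le_trans (ler_wpM2l (normr_ge0 _) gt) _.
by rewrite /eps' mulrCA ger_pMr// ler_pdivrMr// mul1r lerDl.
Unshelve. all: by end_near. Qed.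

(** The direction is built up one basis vector at a time, starting from the zero direction. *)
Lemma is_derive_partials (R : realType) (n : nat) (f : 'cV[R]_n -> R)
    (p : 'I_n -> 'cV[R]_n -> R) (x v : 'cV[R]_n) :
  (\forall y \near x, forall j, is_derive y (delta_mx j 0) f (p j y)) ->
  (forall j, {for x, continuous (p j)}) ->
  is_derive x v f (\sum_j v j 0 * p j x).
Proof.
move=> fp px.
have {1}-> : v = \sum_j v j 0 *: delta_mx j 0.
  rewrite [LHS]matrix_sum_delta; apply: eq_bigr => j _; exact: big_ord1.
elim/big_rec2: _ => [|j d w _ IH]; first exact: is_derive0.
rewrite addrC [_ + d]addrC; apply: is_derive_add_direction => //.
by near=> y; move: j; near: y.
Unshelve. all: by end_near. Qed.

(** If [d > 0], then [g] is positive just to the right of 0, so [f] exceeds [f 0] there by the mean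
    value theorem. *)
Lemma second_derivative_test (R : realType) (f g : R -> R) (d e : R) :
  0 < e -> (forall t : R, `|t| < e -> is_derive t 1 f (g t)) ->
  is_derive (0 : R) 1 g d -> (forall t, `|t| < e -> f t <= f 0) ->
  g 0 = 0 /\ d <= 0.
Proof.
move=> e0 fg gd fmax.
have absP (t : R) : t \in `]- e, e[ -> `|t| < e by rewrite in_itv/= ltr_norml.
have g0 : g 0 = 0.
  have abs0 : `|0 : R| < e by rewrite normr0.
  have [_ <-] := fg _ abs0.
  apply: derive_val; apply: (@derive1_at_max _ f (- e) e) => //.
  - by rewrite ge0_cp// ltW.
  - by move=> t /absP/fg[].
  - by rewrite in_itv/= oppr_lt0 e0.
  - by move=> t /absP/fmax.
split => //; rewrite leNgt; apply/negP => d0.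
have [gder gdE] := gd.
have : (fun h : R => h^-1 *: ((g \o shift 0) (h *: (1 : R)) - g 0)) @ 0^' --> d.
  by rewrite -gdE.
move=> /cvgr_gt /(_ _ d0) /nbhs_ballP[r /= r0 rP].
have gpos h : 0 < h -> h < r -> 0 < g h.
  move=> h0 hr; have /(_ _ _) := rP h; rewrite /ball/= sub0r normrN gtr0_norm//.
  move=> /(_ hr (lt0r_neq0 h0)).
  by rewrite addr0 [_%:A]mulr1 g0 subr0 pmulr_rgt0// invr_gt0.
pose h := Num.min (e / 2) (r / 2).
have h0 : 0 < h by rewrite lt_min !divr_gt0.
have he : h < e by rewrite gt_min ltr_pdivrMr// ltr_pMr// ltr1n.
have hr : h < r by rewrite gt_min orbC ltr_pdivrMr// ltr_pMr// ltr1n.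
have sub (t : R) : t \in `[0, h] -> `|t| < e.
  by rewrite in_itv/= => /andP[t0 th]; rewrite ger0_norm// (le_lt_trans th).
have [||c] := @MVT _ f g _ _ h0.
- by move=> t /subset_itv_oo_cc/sub/fg.
- by apply: derivable_within_continuous => t /sub/fg[].
rewrite in_itv/= subr0 => /andP[c0 ch] E.
have : f h <= f 0 by apply: fmax; rewrite gtr0_norm.
by rewrite -subr_le0 E leNgt mulr_gt0// gpos// (lt_trans ch).
Qed.

Lemma interior_max_conditions (R : realType) (n : nat) (f : 'cV[R]_n -> R)
    (p : 'I_n -> 'cV[R]_n -> R) (q : 'I_n -> 'I_n -> 'cV[R]_n -> R) x :
  (\forall y \near x, forall j, is_derive y (delta_mx j 0) f (p j y)) ->
  (\forall y \near x, forall j, {for y, continuous (p j)}) ->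
  (\forall y \near x, forall j k, is_derive y (delta_mx j 0) (p k) (q j k y)) ->
  (forall j k, {for x, continuous (q j k)}) ->
  (\forall y \near x, f y <= f x) ->
  (forall j, p j x = 0) /\
  (forall v : 'cV[R]_n, \sum_k v k 0 * \sum_j v j 0 * q j k x <= 0).
Proof.
move=> fp pc pq qc fmax.
have test (v : 'cV[R]_n) : \sum_j v j 0 * p j x = 0 /\
    \sum_k v k 0 * \sum_j v j 0 * q j k x <= 0.
  (* The first derivative along [v] is needed at all points near [x], and each of them needs the
     partials in a neighbourhood of its own. *)
  have := near_join fp; have := near_join pc => pcc fpp.
  have : \forall y \near x, is_derive y v f (\sum_j v j 0 * p j y) /\ f y <= f x.
    near=> y; split; last by near: y.
    apply: is_derive_partials; near: y => //.
  move=> /(nbhs_line v)[e e0 eP].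
  have := @second_derivative_test _ (fun t => f (x + t *: v))
    (fun t => \sum_j v j 0 * p j (x + t *: v))
    (\sum_k v k 0 * \sum_j v j 0 * q j k x) _ e0.
  rewrite scale0r addr0; apply.
  - by move=> t /eP[] /is_derive_line.
  - apply/(is_derive_line (fun y => \sum_j v j 0 * p j y)).
    rewrite scale0r addr0.
    have pqv k : is_derive x v (p k) (\sum_j v j 0 * q j k x).
      apply: (@is_derive_partials _ _ (p k) (fun j => q j k)) => [|j]; last exact: qc.
      by apply: filterS pq => y + j => /(_ j k).
    have -> : (fun y => \sum_j v j 0 * p j y) = \sum_(k < n) v k 0 *: p k.
      by apply/funext => y; rewrite fct_sumE.
    apply: (@is_derive_sum _ _ _ n (fun k => v k 0 *: p k) x v
      (fun k => v k 0 *: \sum_j v j 0 * q j k x)).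

  - by move=> t /eP[].
split=> [j|v]; last by have [] := test v.
have [+ _] := test (delta_mx j 0).
have -> : \sum_i (delta_mx j 0 : 'cV[R]_n) i 0 * p i x =
    dot (delta_mx j 0) (\col_i p i x).
  by apply: eq_bigr => i _; rewrite [in RHS]mxE.
by rewrite dot_delta mxE.
Unshelve. all: by end_near. Qed.

(** * The weak maximum principle *)

Lemma is_derive_expR_coord (R : realType) (n : nat) (i j : 'I_n) (r : R)
    (x : 'cV[R]_n) :
  is_derive x (delta_mx j 0) (fun y : 'cV[R]_n => expR (r * y i 0))
    (r * (j == i)%:R * expR (r * x i 0)).
Proof.
pose f (y : 'cV[R]_n) : R := expR (r * y i 0).
have := (is_derive_line f x (delta_mx j 0) 0 (r * (j == i)%:R * f x)).2.
rewrite scale0r addr0; apply.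
pose g (s : R) := r * x i 0 + s * (r * (j == i)%:R).
have -> : (fun s => f (x + s *: delta_mx j 0)) = expR \o g.
  apply/funext => s; rewrite /f /g /= !mxE eqxx andbT eq_sym; congr expR; ring.
have g0 : g 0 = r * x i 0 by rewrite /g mul0r addr0.
rewrite mulrC; apply: is_derive1_comp; first by rewrite g0; exact: is_derive_expR.
have : is_derive (0 : R) 1 (cst (r * x i 0) + (r * (j == i)%:R) *: (id : R -> R))
    (0 + (r * (j == i)%:R) *: 1) by exact: is_deriveD.
rewrite add0r [_ *: 1]mulr1.
suff -> : cst (r * x i 0) + (r * (j == i)%:R) *: (id : R -> R) = g by [].
by apply/funext => s; rewrite /g [s * _]mulrC.
Qed.

Lemma bounded_closure (R : realType) (V : normedModType R) (A : set V) :
  bounded_set A -> bounded_set (closure A).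
Proof.
move=> [M [Mr bM]]; exists M; split => // x Mx y cly.
have norm_closed : closed [set z : V | `|z| <= x].
  apply: (preimage_closed (f := fun z : V => `|z|) (D := [set s : R | s <= x])).
    by move=> z _; exact: norm_continuous.
  exact: closed_le.
move/closure_id : norm_closed => normE.
suff : [set z : V | `|z| <= x] y by [].
by rewrite normE; apply: closureS cly => z; exact: bM.
Qed.

Lemma norm_coord_le (R : realType) (m n : nat) (A : 'M[R]_(m, n)) i j :
  `|A i j| <= `|A|.
Proof.
rewrite [leRHS]/Num.norm/= mx_normrE.
exact: (le_bigmax _ (fun p => `|A p.1 p.2|) (i, j)).
Qed.

(* The barrier [expR (lam * y j0 0)] is a strict subsolution for large [lam]. *)
Lemma weak_maximum_principle (R : realType) (n : nat) (Omega : set 'cV[R]_n)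
    (v : 'cV[R]_n -> R) (p b : 'I_n -> 'cV[R]_n -> R)
    (q a : 'I_n -> 'I_n -> 'cV[R]_n -> R) (j0 : 'I_n) (delta M c : R) :
  open Omega -> bounded_set Omega -> {within closure Omega, continuous v} ->
  (forall x, Omega x -> forall j, is_derive x (delta_mx j 0) v (p j x)) ->
  (forall x, Omega x -> forall j, {for x, continuous (p j)}) ->
  (forall x, Omega x ->
    forall j k, is_derive x (delta_mx j 0) (p k) (q j k x)) ->
  (forall x, Omega x -> forall j k, {for x, continuous (q j k)}) ->
  (forall x, Omega x -> forall j k, a j k x = a k j x) ->
  0 < delta ->
  (forall x, Omega x -> forall sigma : 'cV[R]_n,
    delta * dot sigma sigma <=
    \sum_j \sum_k sigma j 0 * sigma k 0 * a j k x) ->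
  (forall x, Omega x -> - M <= b j0 x) ->
  (forall x, Omega x ->
    0 <= \sum_j \sum_k a j k x * q j k x + \sum_j b j x * p j x) ->
  (forall x, boundary Omega x -> v x <= c) ->
  forall x, Omega x -> v x <= c.
Proof.
move=> oO bO v_cont vp p_cont pq q_cont a_sym d0 a_ell b_ge sub bnd x Ox.
have bcl := bounded_closure bO.
have [K K0 clK] : exists2 K, 0 <= K & forall y, closure Omega y -> `|y| <= K.
  move: bcl => [K [Kr bK]]; exists (`|K| + 1); first by rewrite addr_ge0.
  by move=> y /bK; apply; rewrite ltr_pwDr// ler_norm.
(* Then [lam * delta = |M| + 1], so [lam * a j0 j0 + b j0] is at least 1 throughout [Omega]. *)
pose lam := (`|M| + 1) / delta.
have lam0 : 0 < lam by rewrite divr_gt0// ltr_wpDl.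
pose E (y : 'cV[R]_n) : R := expR (lam * y j0 0).
have E_cont : continuous E.
  move=> y; apply: (@continuous_comp _ _ _ (fun z : 'cV[R]_n => lam * z j0 0)).
    by apply: continuousM; [exact: cst_continuous|exact: coord_continuous].
  exact: continuous_expR.
have E_gt0 y : 0 < E y by exact: expR_gt0.
pose B := expR (lam * K).
have EB y : closure Omega y -> E y <= B.
  move=> /clK yK; rewrite ler_expR ler_wpM2l ?(ltW lam0)//.
  by rewrite (le_trans (ler_norm _))// (le_trans (norm_coord_le _ _ _)).
apply/ler_addgt0Pr => eps eps0.
(* The barrier term [kap * E] is positive and at most [eps] on the closure, so comparing [w] with
   its maximum costs at most [eps]. *)
pose kap := eps / B; have kap0 : 0 < kap by rewrite divr_gt0// expR_gt0.
pose w y := v y + kap * E y.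
have w_cont : {within closure Omega, continuous w}.
  move=> y; apply: cvgD; first exact: v_cont.
  apply: cvgM; first exact: cvg_cst.
  exact: (continuous_subspaceT E_cont).
have clx : closure Omega x by exact: subset_closure.
have [z clz wmax] := compact_EVT_max (ex_intro _ _ clx)
  (bounded_closed_compact_cV bcl (@closed_closure _ Omega)) w_cont.
rewrite inE in clz.
have {}wmax y : closure Omega y -> w y <= w z by move=> ?; apply: wmax; rewrite inE.
have [Oz|nOz] := pselect (Omega z); last first.
  have : v z <= c by apply: bnd; split => //; rewrite (interior_id _).1.
  have : kap * E z <= eps.
    by rewrite /kap mulrAC ler_pdivrMr ?expR_gt0// ler_wpM2l ?(ltW eps0)// EB.
  have : v x <= w x by rewrite lerDl mulr_ge0// ltW.
  have := wmax _ clx; rewrite {2}/w; lra.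
exfalso.
pose pw j y := p j y + kap * (lam * (j == j0)%:R * E y).
pose qw j k y := q j k y + kap * lam * (k == j0)%:R * (lam * (j == j0)%:R * E y).
have nearO : \forall y \near z, Omega y by exact: open_nbhs_nbhs.
have [pw0 Hess] : (forall j, pw j z = 0) /\
    (forall xi : 'cV[R]_n, \sum_k xi k 0 * \sum_j xi j 0 * qw j k z <= 0).
  apply: (@interior_max_conditions _ _ w).
  - apply: filterS nearO => y Oy j.
    have := vp _ Oy j => vpy.
    have Ey := is_derive_expR_coord j0 j lam y.
    exact: (is_deriveD vpy (is_deriveZ kap Ey)).
  - apply: filterS nearO => y Oy j; apply: continuousD; first exact: p_cont.
    apply: continuousM; first exact: cst_continuous.
    by apply: continuousM; [exact: cst_continuous|exact: E_cont].
  - apply: filterS nearO => y Oy j k.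
    have pqy := pq _ Oy j k.
    have Ey := is_derive_expR_coord j0 j lam y.
    have := is_deriveD pqy (is_deriveZ (kap * lam * (k == j0)%:R) Ey).
    suff -> : p k + (kap * lam * (k == j0)%:R) *: E = pw k by [].
    by apply/funext => u; rewrite /pw !mulrA.
  - move=> j k; apply: continuousD; first exact: q_cont.
    apply: continuousM; first exact: cst_continuous.
    by apply: continuousM; [exact: cst_continuous|exact: E_cont].
  - by apply: filterS nearO => y Oy; apply: wmax; exact: subset_closure.
have tr : \sum_j \sum_k a j k z * qw j k z <= 0.
  (* The Hessian enters with its indices exchanged, to match the form in [Hess]; exchanging the sums
     and the symmetry of [a] restore the order. *)
  have := @symmetric_psd_trace_le0 _ _ (\matrix_(j, k) a j k z)
    (\matrix_(k, j) qw j k z).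
  rewrite exchange_big/=.
  under eq_bigr do under eq_bigr do rewrite !mxE -a_sym//.
  apply.
  - by apply/matrixP => j k; rewrite !mxE a_sym.
  - move=> xi; have := a_ell _ Oz xi; rewrite /dot => h.
    apply: le_trans (le_trans h _); first by rewrite mulr_ge0 ?(ltW d0)//; exact: dot_ge0.
    apply: ler_sum => j _; rewrite mxE mulr_suml; apply: ler_sum => k _.
    by rewrite mxE; lra.
  - move=> xi; have := Hess xi; congr (_ <= 0); apply: eq_bigr => k _.
    rewrite mxE mulrC; congr (_ * _); apply: eq_bigr => j _.
    by rewrite mxE mulrC.
have a00 : delta <= a j0 j0 z.
  have := a_ell _ Oz (delta_mx j0 0); rewrite dot_delta mxE !eqxx mulr1.
  rewrite (bigD1 j0)//= (bigD1 j0)//= !mxE !eqxx !mul1r big1 => [|k kj]; last first.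
    by rewrite !mxE (negbTE kj) mulr0 mul0r.
  rewrite big1 ?addr0// => j jj; rewrite big1// => k _.
  by rewrite mxE (negbTE jj) !mul0r.
have trE : \sum_j \sum_k a j k z * qw j k z =
    \sum_j \sum_k a j k z * q j k z + kap * lam ^+ 2 * E z * a j0 j0 z.
  have -> : kap * lam ^+ 2 * E z * a j0 j0 z =
    \sum_j \sum_k (j == j0)%:R * (k == j0)%:R * (kap * lam ^+ 2 * E z * a j k z).
    rewrite (bigD1 j0)//= (bigD1 j0)//= !eqxx !mul1r big1 => [|k kj]; last first.
      by rewrite (negbTE kj) mulr0 mul0r.
    rewrite big1 ?addr0// => j jj; rewrite big1// => k _.
    by rewrite (negbTE jj) !mul0r.
  rewrite -big_split; apply: eq_bigr => j _; rewrite -big_split.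
  by apply: eq_bigr => k _; rewrite /qw/=; ring.
have bpE : \sum_j b j z * p j z = - (kap * lam * E z * b j0 z).
  rewrite (bigD1 j0)//= big1 ?addr0 => [|j jj].
    by have := pw0 j0; rewrite /pw eqxx mulr1 => /eqP; rewrite addr_eq0 => /eqP ->; ring.
  have := pw0 j; rewrite /pw (negbTE jj) mulr0 mul0r mulr0 addr0 => ->.
  by rewrite mulr0.
(* Combining [tr] with the subsolution inequality at [z] yields [kap * lam * E z * (lam * a j0 j0 z
   + b j0 z) <= 0], while the choice of [lam] makes this product positive. *)
have := sub _ Oz; rewrite bpE; move: tr; rewrite trE.
have kle0 : 0 < kap * lam * E z by apply: mulr_gt0 (E_gt0 z); exact: mulr_gt0.
have : 0 < kap * lam * E z * (lam * a j0 j0 z + b j0 z).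
  apply: mulr_gt0 => //.
  have : lam * delta <= lam * a j0 j0 z by rewrite ler_pM2l.
  rewrite {1}/lam mulfVK ?gt_eqF//.
  have := ler_norm M; have := b_ge _ Oz; lra.
lra.
Qed.

(** * Reduction of the system to a scalar equation *)

Lemma is_derive_dot (R : realType) (V : normedModType R) (m : nat)
    (f : V -> 'cV[R]_m) (nu : 'cV[R]_m) x e d :
  is_derive x e f d -> is_derive x e (fun y => dot nu (f y)) (dot nu d).
Proof.
move=> [fx <-].
suff cv : (fun h : R => h^-1 *: (((fun y => dot nu (f y)) \o shift x) (h *: e) -
    dot nu (f x))) @ 0^' --> dot nu ('D_e f x).
  by apply: DeriveDef; [apply/cvg_ex; exists (dot nu ('D_e f x))|exact/cvg_lim].
have -> : (fun h : R => h^-1 *: (((fun y => dot nu (f y)) \o shift x) (h *: e) -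
    dot nu (f x))) = dot nu \o (fun h => h^-1 *: ((f \o shift x) (h *: e) - f x)).
  by apply/funext => h /=; rewrite dotZr dotBr.
by apply: continuous_cvg => //; exact: dot_continuous.
Qed.

(** As [nu] is a unit vector, [l] is the form of the transpose at [nu]: a sum of [m * m] terms, each
    an entry of [A] times two coordinates of size at most 1. *)
Lemma eigenvalue_bounded (R : realType) (m : nat) (A : 'M[R]_m) nu (l : R) :
  dot nu nu = 1 -> A^T *m nu = l *: nu -> `|l| <= `|A| * (m * m)%:R.
Proof.
move=> nn Anu.
have -> : l = \sum_i (\sum_k A k i * nu k 0) * nu i 0.
  rewrite -[LHS]mulr1 -nn -dotZl -Anu; apply: eq_bigr => i _.
  by rewrite mxE; congr (_ * _); apply: eq_bigr => k _; rewrite mxE.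
have nu_le1 i : `|nu i 0| <= 1.
  rewrite -(expr_le1 (n := 2))// real_normK ?num_real// -nn.
  exact: coord_dot_le.
rewrite natrM mulrA.
apply: le_trans (ler_norm_sum _ _ _) _.
apply: (@le_trans _ _ (\sum_(i < m) `|A| * m%:R)); last first.
  by rewrite sumr_const card_ord -[leLHS]mulr_natr.
apply: ler_sum => i _; rewrite normrM -[leRHS]mulr1; apply: ler_pM => //.
apply: le_trans (ler_norm_sum _ _ _) _.
apply: (@le_trans _ _ (\sum_(k < m) `|A|)); last first.
  by rewrite sumr_const mulr_natr card_ord.
apply: ler_sum => k _; rewrite normrM -[leRHS]mulr1; apply: ler_pM => //.
exact: norm_coord_le.
Qed.

Theorem theorem1 (R : realType) (n m : nat) (n_gt0 : (0 < n)%N)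
    (Omega : set 'cV[R]_n)
    (Omega_domain : domain Omega) (Omega_bounded : bounded_set Omega)
    (A2 : 'I_n -> 'I_n -> 'cV[R]_n -> 'M[R]_m)
    (A1 : 'I_n -> 'cV[R]_n -> 'M[R]_m)
    (A2_sym : forall j k x, Omega x -> A2 j k x = A2 k j x)
    (A2_bounded : forall j k, [bounded A2 j k x | x in Omega])
    (A1_bounded : forall j, [bounded A1 j x | x in Omega])
    (A2_elliptic : uniformly_strongly_elliptic Omega A2)
    (S : set 'cV[R]_m) (S_body : convex_body S)
    (a2 : 'I_n -> 'I_n -> 'cV[R]_n -> 'cV[R]_m -> R)
    (a1 : 'I_n -> 'cV[R]_n -> 'cV[R]_m -> R)
    (A2_nu : forall j k x nu, Omega x -> unit_normals S nu ->
      (A2 j k x)^T *m nu = a2 j k x nu *: nu)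
    (A1_nu : forall j x nu, Omega x -> unit_normals S nu ->
      (A1 j x)^T *m nu = a1 j x nu *: nu) :
  invariant_set (second_order_op A2 A1) Omega S.
Proof.
move=> u [_ u1 u2] u_cont _ Lu0 u_bd x Ox; apply: contrapT => nSux.
have [nu [b [Nnu Sb bu]]] := unit_normal_separates S_body nSux.
have [oO _ _] := Omega_domain.
have nn : dot nu nu = 1.
  by have [y _ [[nu1 _] _]] := Nnu; rewrite -sqr_enorm nu1 expr1n.
have [delta d0 ell] := A2_elliptic.
pose j0 : 'I_n := Ordinal n_gt0.
have [K K0 A1K] := ex_strict_bound_gt0 (A1_bounded j0).
(* Moving [A2 j k y] across the inner product as its transpose turns it into a scalar acting on
   [nu]; this decouples the component [dot nu u]. *)
have a2E j k y (w : 'cV[R]_m) : Omega y ->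
    dot nu (A2 j k y *m w) = a2 j k y nu * dot nu w.
  by move=> Oy; rewrite dotC dot_mulmx A2_nu// dotZr dotC.
have a1E j y (w : 'cV[R]_m) : Omega y ->
    dot nu (A1 j y *m w) = a1 j y nu * dot nu w.
  by move=> Oy; rewrite dotC dot_mulmx A1_nu// dotZr dotC.
have cont_dot (f : 'cV[R]_n -> 'cV[R]_m) y :
    {for y, continuous f} -> {for y, continuous (fun z => dot nu (f z))}.
  by move=> fy; apply: (continuous_comp fy); exact: dot_continuous.
suff : dot nu (u x) <= b by rewrite leNgt bu.
apply: (@weak_maximum_principle _ _ Omega (fun y => dot nu (u y))
  (fun j y => dot nu (partial j u y)) (fun j y => a1 j y nu)
  (fun j k y => dot nu (partial j (partial k u) y)) (fun j k y => a2 j k y nu)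
  j0 delta (K * (m * m)%:R) b) => //.
- by move=> y; apply: continuous_comp; [exact: u_cont|exact: dot_continuous].
- by move=> y Oy j; apply/is_derive_dot/derivableP; exact: (u1 j).1.
- by move=> y Oy j; apply: cont_dot; exact: (u1 j).2.
- by move=> y Oy j k; apply/is_derive_dot/derivableP; exact: (u2 j k).1.
- by move=> y Oy j k; apply: cont_dot; exact: (u2 j k).2.
(* Taking [w = nu] writes the eigenvalue as [dot nu (A2 j k y *m nu)], which inherits the symmetry
   in [j] and [k]. *)
- move=> y Oy j k; have := a2E j k y nu Oy.
  by rewrite A2_sym// a2E// nn !mulr1.
(* Strong ellipticity at [zeta = nu] is scalar ellipticity with the same [delta]. *)
- move=> y Oy sigma; have := ell sigma nu y Oy.
  rewrite !sqr_enorm nn mulr1 => /le_trans; apply.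
  rewrite dotC mulmx_suml dot_sumr; apply: ler_sum => j _.
  rewrite mulmx_suml dot_sumr; apply: ler_sum => k _.
  by rewrite -scalemxAl dotZr a2E// nn mulr1.
- move=> y Oy; rewrite lerNl (le_trans (ler_norm _))// normrN.
  apply: le_trans (eigenvalue_bounded nn (A1_nu j0 _ _ Oy Nnu)) _.
  by rewrite ler_wpM2r// ltW//; exact: A1K.
- move=> y Oy; have := congr1 (dot nu) (Lu0 y Oy).
  rewrite dotDr !dot_sumr.
  under eq_bigr do rewrite dot_sumr; under eq_bigr do under eq_bigr do rewrite a2E//.
  under [X in _ + X]eq_bigr do rewrite a1E//.
  by move=> ->; rewrite /dot big1// => i _; rewrite mxE mulr0.
- by move=> y /u_bd/Sb.
Qed.
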